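(* Let $V$ be a finite set (case $q=1$) or a finite-dimensional $\mathbb{F}_q$-vector space (case $q\ge 2$ a prime power), let $n=\operatorname{rk}V$, $k\in\{0,\ldots,n\}$, $t\in\{0,\ldots,\min(k,n-k)\}$, and put $\lambda_{\max}={n-t\brack k-t}_q$. Let $f:{V\brack k}\to\mathbb{R}$. The following are equivalent: (i) $f\in\bar V_t^{(k)}$. (ii) There is a constant $c\in\mathbb{R}$ such that $\langle f,\delta\rangle=\lambda c$ for all $\lambda\in\mathbb{R}$ and all real $t$-$(n,k,\lambda)_q$ designs $\delta:{V\brack k}\to\mathbb{R}$. (iii) $\langle f,\delta\rangle=0$ for all signed $t$-$(n,k,0)_q$ null designs $\delta:{V\brack k}\to\mathbb{Z}$. (iv) There is a constant $c\in\mathbb{R}$ such that $\langle f,\delta\rangle=\lambda c$ for all $\lambda\in\mathbb{N}$ and all possibly non-simple $t$-$(n,k,\lambda)_q$ designs $\delta:{V\brack k}\to\mathbb{N}$. Moreover, the constant $c$ in (ii) and in (iv) necessarily equals $\frac{1}{\lambda_{\max}}\cdot\#f$.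
   Context: $\mathbb{N}=\{0,1,2,\ldots\}$. For $q=1$, ''subspaces'' of $V$ are subsets and $\operatorname{rk}U=\#U$; for $q\ge2$ they are $\mathbb{F}_q$-linear subspaces and $\operatorname{rk}U=\dim U$. $U\le W$ means inclusion. ${V\brack k}$ is the set of all subspaces of $V$ of rank $k$; its cardinality is the Gaussian binomial coefficient ${n\brack k}_q$ (the ordinary binomial coefficient for $q=1$). For $f,g:{V\brack k}\to\mathbb{R}$: $\langle f,g\rangle=\sum_{K\in{V\brack k}}f(K)g(K)$ and $\#f=\sum_{K\in{V\brack k}}f(K)$. For a subspace $U$ of $V$, $\boldsymbol{x}_U^{(k)}:{V\brack k}\to\mathbb{R}$ is the characteristic function of $\{K\in{V\brack k}\mid U\le K\}$. $\bar V_t^{(k)}\subseteq\mathbb{R}^{{V\brack k}}$ is the real linear span of the functions $\boldsymbol{x}_T^{(k)}$, $T\in{V\brack t}$ (equivalently the row space of the $t$-versus-$k$ inclusion matrix). For $\lambda\in\mathbb{R}$, a function $\delta:{V\brack k}\to\mathbb{R}$ is a real $t$-$(n,k,\lambda)_q$ design if $\langle\boldsymbol{x}_T^{(k)},\delta\rangle=\lambda$ for every $T\in{V\brack t}$; it is a signed design if all its values are in $\mathbb{Z}$, and a (possibly non-simple) design if all its values are in $\mathbb{N}$. A null design is a design with $\lambda=0$. *)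

(* Defs.v *)
From HB Require Import structures.
From mathcomp Require Import all_boot all_order all_algebra.
From mathcomp Require Import reals.

Set Implicit Arguments.
Unset Strict Implicit.
Unset Printing Implicit Defensive.

Import GRing.Theory Num.Theory.
Import VectorInternalTheory.
Local Open Scope ring_scope.

HB.instance Definition _ (F : finFieldType) (W : vectType F) :=
  [Countable of {vspace W} by <:].
HB.instance Definition _ (F : finFieldType) (W : vectType F) :=
  [Finite of {vspace W} by <:].

Inductive ambient : Type :=
| SetAmbient of finType
| VectAmbient (F : finFieldType) of vectType F.

Definition ambient_q (V : ambient) : nat :=
  match V with
  | SetAmbient _ => 1
  | @VectAmbient F _ => #|F|
  end.

Definition subspace (V : ambient) : finType :=
  match V with
  | SetAmbient T => {set T}
  | VectAmbient _ W => {vspace W}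
  end.

Definition rk (V : ambient) : subspace V -> nat :=
  match V return subspace V -> nat with
  | SetAmbient T => fun U : {set T} => #|U|
  | VectAmbient _ W => fun U : {vspace W} => \dim U
  end.

Definition incl (V : ambient) : rel (subspace V) :=
  match V return rel (subspace V) with
  | SetAmbient T => fun U W : {set T} => U \subset W
  | VectAmbient _ X => fun U W : {vspace X} => (U <= W)%VS
  end.

Definition whole (V : ambient) : subspace V :=
  match V return subspace V with
  | SetAmbient T => [set: T]
  | VectAmbient _ W => fullv
  end.

Definition ambient_rk (V : ambient) : nat := rk (whole V).

Definition grass (V : ambient) (k : nat) : finType :=
  {U : subspace V | rk U == k}.

(* In the second branch the truncated [n - i] is harmless: for [n < k] the
   factor [i = n] is zero, as it should be. *)
Definition gauss_binom (R : realType) (q n k : nat) : R :=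
  if q == 1%N then 'C(n, k)%:R
  else \prod_(i < k) ((q%:R ^+ (n - i) - 1) / (q%:R ^+ i.+1 - 1)).

Section RealFunctions.
Variables (R : realType) (V : ambient) (k : nat).

(* [R^o] gives the functions their structure of real vector space. *)
Definition gfun := {ffun grass V k -> R^o}.

Definition inner (f g : gfun) : R := \sum_K (f K : R) * (g K : R).

Definition weight (f : gfun) : R := \sum_K (f K : R).

Definition charfun (U : subspace V) : gfun :=
  [ffun K : grass V k => (incl U (val K))%:R].

Definition inclusion_span (t : nat) : {vspace gfun} :=
  <<[seq charfun (val T) | T : grass V t]>>%VS.

Definition real_design (t : nat) (lambda : R) (delta : gfun) : Prop :=
  forall T : grass V t, inner (charfun (val T)) delta = lambda.

Definition signed_design (t : nat) (lambda : R) (delta : gfun) : Prop :=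
  real_design t lambda delta /\ forall K, (delta K : R) \is a Num.int.

Definition nat_design (t : nat) (lambda : R) (delta : gfun) : Prop :=
  real_design t lambda delta /\ forall K, (delta K : R) \is a Num.nat.

Definition real_design_constant (t : nat) (f : gfun) (c : R) : Prop :=
  forall (lambda : R) (delta : gfun),
    real_design t lambda delta -> inner f delta = lambda * c.

Definition nat_design_constant (t : nat) (f : gfun) (c : R) : Prop :=
  forall (lambda : nat) (delta : gfun),
    nat_design t lambda%:R delta -> inner f delta = lambda%:R * c.

End RealFunctions.

(* Main.v *)
Require Import Defs.
From mathcomp Require Import all_boot all_order all_algebra.
From mathcomp Require Import reals.
From mathcomp Require Import finfield zify.

(** The functions satisfying (i) form the row space of the inclusion matrix,
    and (ii)-(iv) say that [f] annihilates its kernel, tested on various null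
    designs.  The constant function [1] is a [lambda_max]-design: adding a
    multiple of it turns an integral null design into a nonnegative one, and
    subtracting one turns a design into a null design.  The inclusion matrix is
    rational, so its real kernel is spanned by integral vectors; hence integral
    null designs suffice to recover (i). *)

Import Order.TTheory GRing.Theory Num.Theory.
Local Open Scope ring_scope.

(** * Gaussian binomial coefficients *)

(** This is the recursion that the double count of subspaces yields. The first numerator factor and
    the last denominator factor are split off; for [n = 0] both sides vanish. *)
Lemma gauss_binomS (R : realType) (q n k : nat) : (1 < q)%N ->
  gauss_binom R q n k.+1 * (q%:R ^+ k.+1 - 1) =
  (q%:R ^+ n - 1) * gauss_binom R q n.-1 k.
Proof.
move=> q1; rewrite /gauss_binom gtn_eqF // !prodf_div.
rewrite big_ord_recl big_ord_recr /= subn0 invfM -!mulrA mulVf ?mulr1;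
  last first.
  by rewrite subr_eq0 gt_eqF // exprn_egt1 ?ltr1n.
congr (_ * (_ * _)); apply: eq_bigr => i _.
by rewrite -subn1 -subnDA add1n.
Qed.

(** This permits division by [lambda_max]. If [q > 1], the exponents [n - i] and [i.+1] are positive
    for [i < k <= n], so no factor vanishes. *)
Lemma gauss_binom_neq0 (R : realType) (q n k : nat) :
  (0 < q)%N -> (k <= n)%N -> gauss_binom R q n k != 0.
Proof.
move=> q0 kn; rewrite /gauss_binom; case: (eqVneq q 1%N) => [_|q1].
  by rewrite pnatr_eq0 -lt0n bin_gt0.
apply/prodf_neq0 => i _.
have neq0 m : (0 < m)%N -> (q%:R : R) ^+ m - 1 != 0.
  move=> m0; rewrite subr_eq0 gt_eqF // exprn_egt1 -?lt0n // ltr1n; lia.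
by rewrite mulf_neq0 ?invr_eq0 ?neq0 // subn_gt0 (leq_trans (ltn_ord i)).
Qed.

(** * Counting the subspaces above a given one *)

(** The map sending [B] to the union of [A] and [B] is a bijection from the [j]-subsets of the
    complement of [A] onto the sets counted. *)
Lemma card_set_over (T : finType) (A : {set T}) (j : nat) :
  #|[pred K : {set T} | (A \subset K) && (#|K| == #|A| + j)%N]| =
  'C(#|T| - #|A|, j).
Proof.
have <- : #|~: A| = (#|T| - #|A|)%N by rewrite cardsCs setCK.
rewrite -cards_draws.
rewrite -(@card_in_imset _ _ (setU A)); last first.
  move=> B C; rewrite !inE => /andP[BA _] /andP[CA _].
  move=> /(congr1 (fun K : {set T} => K :\: A)).
  rewrite !setDUl !setDv !set0U !setDE.
  by move/setIidPl: BA => ->; move/setIidPl: CA => ->.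
apply: eq_card => K; rewrite !inE; apply/andP/imsetP => [[AK /eqP cK]|[B]].
  exists (K :\: A); last by rewrite -{1}(setIidPr AK) setID.
  by rewrite inE setDE subsetIr -setDE cardsD (setIidPr AK) cK addKn eqxx.
rewrite inE => /andP[BA /eqP <-] ->; rewrite subsetUl; split=> //.
rewrite cardsU setIC; suff -> : B :&: A = set0 by rewrite cards0 subn0.
by apply/eqP; rewrite setI_eq0 disjoints_subset.
Qed.

Section VectorCounting.
Variables (F : finFieldType) (W : vectType F).
Implicit Types (K T : {vspace W}).

Lemma card_mem_vspace K :
  #|[pred v : finvect_type W | (v : W) \in K]| = (#|F| ^ \dim K)%N.
Proof.
case: W K => wT cT K.
exact: (@card_vspace F (finvect_type (Vector.Pack cT)) cT K).
Qed.

Lemma card_mem_vspaceD K T : (T <= K)%VS ->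
  #|[pred v : finvect_type W | ((v : W) \in K) && ((v : W) \notin T)]| =
  (#|F| ^ \dim K - #|F| ^ \dim T)%N.
Proof.
move=> TK; rewrite -!card_mem_vspace.
rewrite -(cardID [pred v : finvect_type W | (v : W) \in T]
            [pred v : finvect_type W | (v : W) \in K]).
rewrite [X in (X + _ - _)%N](_ : _ =
    #|[pred v : finvect_type W | (v : W) \in T]|).
  by rewrite addKn; apply: eq_card => v; rewrite !inE andbC.
apply: eq_card => v; rewrite !inE andbC.
by apply/andP/idP => [[]//|vT]; split=> //; apply: subvP vT.
Qed.

Definition vspaces_over T (j : nat) :=
  [pred K : {vspace W} | (T <= K)%VS && (\dim K == \dim T + j)%N].

Lemma dimv_add_line T (v : W) : v \notin T -> \dim (T + <[v]>) = (\dim T).+1.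
Proof.
move=> vT; have v0 : v != 0 by apply: contraNneq vT => ->; rewrite mem0v.
rewrite dimv_disjoint_sum ?dim_vline ?v0 ?addn1 //.
apply/eqP; rewrite -subv0; apply/subvP => u; rewrite memv_cap memv0.
case/andP=> uT /vlineP[a ua]; rewrite ua scaler_eq0 (negPf v0) orbF.
by apply: contraNT vT => a0; rewrite -(scalerK a0 v) -ua memvZ.
Qed.

(* Double counting of the pairs [(v, K)] with [v] in [K] but not in [T]. *)
Lemma card_vspaces_overS T j :
  (#|vspaces_over T j.+1| * (#|F| ^ (\dim T + j.+1) - #|F| ^ \dim T) =
   \sum_(v : finvect_type W | (v : W) \notin T)
      #|vspaces_over (T + <[(v : W)]>) j|)%N.
Proof.
rewrite -sum_nat_const.
transitivity (\sum_(K in vspaces_over T j.+1)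
   \sum_(v : finvect_type W | ((v : W) \in K) && ((v : W) \notin T)) 1)%N.
  apply: eq_bigr => K; rewrite inE => /andP[TK /eqP <-].
  by rewrite sum1_card -card_mem_vspaceD.
rewrite (exchange_big_dep (fun v : finvect_type W => (v : W) \notin T)) /=;
  last first.
  by move=> K v _ /andP[].
(* For [v] outside [T], a subspace contains [T] and [v] iff it contains [T + <[v]>], whose dimension
   is one more than that of [T]. *)
apply: eq_bigr => v vT; rewrite sum1_card; apply: eq_card => K.
rewrite !inE subv_add -memvE dimv_add_line // [LHS]/in_mem /= vT andbT.
by rewrite addSnnS [in LHS]inE andbAC.
Qed.

(** Induction on [j] for all [T] at once: the count above [T + <[v]>] is the same for every [v]
    outside [T], so the sum in the double count is a plain product. *)
Lemma card_vspaces_over (R : realType) T j :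
  #|vspaces_over T j|%:R =
  gauss_binom R #|F| (\dim {:W} - \dim T) j.
Proof.
have q1 := finNzRing_gt1 F.
elim: j T => [|j IH] T.
  rewrite /gauss_binom gtn_eqF // big_ord0 (_ : #|_| = 1%N) // -(card1 T).
  apply: eq_card => K; rewrite !inE addn0 (eq_sym K) eqEdim.
  by case TK: (T <= K)%VS => //=; rewrite eqn_leq (dimvS TK) andbT.
have qX m : (#|F| ^ m)%:R = (#|F|%:R : R) ^+ m by rewrite natrX.
have leqX a b : (a <= b)%N -> (#|F| ^ a <= #|F| ^ b)%N by rewrite leq_exp2l.
have dn : (\dim T <= \dim {:W})%N by rewrite dimvS ?subvf.
have := congr1 (fun m => m%:R : R) (card_vspaces_overS T j).
rewrite natrM natrB ?leqX ?leq_addr // natr_sum.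
under eq_bigr => v vT do rewrite IH dimv_add_line // subnS.
rewrite sumr_const (eq_card (B := [pred v : finvect_type W |
  ((v : W) \in {:W}%VS) && ((v : W) \notin T)])); last first.
  by move=> v; rewrite !inE memvf.
rewrite card_mem_vspaceD ?subvf // -[RHS]mulr_natl natrB ?leqX // !qX.
have expD_sub (x : R) a m : x ^+ (a + m) - x ^+ a = x ^+ a * (x ^+ m - 1).
  by rewrite exprD mulrBr mulr1.
(* Both sides carry the factor [#|F| ^+ \dim T]; cancelling it leaves the recursion
   [gauss_binomS]. *)
rewrite expD_sub -{1}(subnKC dn) expD_sub => eq_count.
have q_neq0 : (#|F|%:R : R) ^+ \dim T != 0.
  by rewrite expf_neq0 // pnatr_eq0 -lt0n ltnW.
have qj_neq0 : (#|F|%:R : R) ^+ j.+1 - 1 != 0.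
  by rewrite subr_eq0 gt_eqF // exprn_egt1 ?ltr1n.
apply: (mulIf qj_neq0); apply: (mulfI q_neq0).
by rewrite gauss_binomS // mulrCA eq_count !mulrA.
Qed.
End VectorCounting.

Lemma exists_vspace_dim (F : finFieldType) (W : vectType F) (d : nat) :
  (d <= \dim {:W})%N -> exists T : {vspace W}, \dim T == d.
Proof.
move=> le_d; exists <<take d (vbasis {:W})>>%VS.
have := basis_free (vbasisP {:W}); rewrite -{1}(cat_take_drop d (vbasis _)).
move=> /catl_free; rewrite /free => /eqP ->.
by rewrite size_takel ?size_tuple.
Qed.

Lemma exists_grass (V : ambient) (k : nat) :
  (k <= ambient_rk V)%N -> exists K : subspace V, rk K == k.
Proof.
case: V => [T|F W]; rewrite /ambient_rk /=; last exact: exists_vspace_dim.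
rewrite cardsT -bin_gt0 -card_draws => /card_gt0P[A].
by rewrite inE; exists A.
Qed.

Lemma card_grass_over (R : realType) (V : ambient) (k : nat) (U : subspace V) :
  (rk U <= k)%N ->
  #|[pred K : grass V k | incl U (val K)]|%:R =
  gauss_binom R (ambient_q V) (ambient_rk V - rk U) (k - rk U).
Proof.
move=> le_Uk; rewrite -(card_image val_inj).
rewrite (eq_card (B := [pred K : subspace V | incl U K & rk K == k]));
  last first.
  move=> K; apply/imageP/andP => [[L]|[UK rkK]]; last by exists (exist _ K rkK).
  by rewrite inE => UL ->; split=> //; apply: (valP L).
rewrite -{1}(subnKC le_Uk); move: (k - rk U)%N => j {k le_Uk}.
case: V U => [T|F W] /= U; last exact: card_vspaces_over.
by rewrite card_set_over /ambient_rk /= cardsT.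
Qed.

(** * Row spaces of rational matrices *)

Lemma clear_denominators {n : nat} (x : 'cV[rat]_n) :
  exists (d : int) (y : 'cV[int]_n),
    d != 0 /\ map_mx intr y = (d%:~R : rat) *: x.
Proof.
pose d := \prod_(i < n) denq (x i ord0); exists d.
exists (\col_i (numq (x i ord0) * \prod_(j < n | j != i) denq (x j ord0))).
split; first by apply/prodf_neq0 => i _; apply: denq_neq0.
apply/matrixP => i j; rewrite !mxE (ord1 j) /d [in RHS](bigD1 i) //=.
rewrite !intrM numqE.
by rewrite -mulrA [LHS]mulrC.
Qed.

(* The relations among the columns of a rational matrix are spanned by
   rational, hence by integral, ones. *)
Lemma rational_row_space {R : archiRealFieldType} {m n : nat}
    (A : 'M[rat]_(m, n)) (v : 'rV[R]_n) :
  (forall y : 'cV[int]_n, A *m map_mx intr y = 0 ->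
     v *m map_mx intr y = 0) ->
  (v <= map_mx ratr A)%MS.
Proof.
(* Lying in the row space means annihilating the columns of the cokernel. Forming the cokernel
   commutes with [ratr], so these columns are rational and can be tested after clearing
   denominators. *)
move=> v_orth; rewrite submxE -map_cokermx; apply/eqP.
move: (cokermx A) (mulmx_coker A) => C AC.
apply/matrixP => i j; rewrite [RHS]mxE.
have [d [y [d_neq0 yE]]] := clear_denominators (col j C).
have yRE : map_mx intr y = (d%:~R : R) *: col j (map_mx ratr C).
  rewrite -map_col -[d%:~R](ratr_int R) -map_mxZ -yE.
  apply/matrixP => a b; rewrite !mxE; apply/esym/ratr_int.
have := v_orth y; rewrite yE yRE !colE -!scalemxAr !mulmxA  AC mul0mx.
rewrite scaler0 -colE => /(_ erefl) /matrixP /(_ i ord0).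
rewrite [LHS]mxE [X in _ * X]mxE [RHS]mxE => /eqP.
by rewrite mulf_eq0 intr_eq0 (negPf d_neq0) => /eqP.
Qed.

(** * Pairing functions with designs *)

Section Designs.
Context {R : realType} {V : ambient} {k t : nat}.
Implicit Types f delta : gfun R V k.

Lemma inner_sumZl {I : finType} (a : I -> R) (g : I -> gfun R V k) delta :
  inner (\sum_i (a i : R) *: g i) delta = \sum_i a i * inner (g i) delta.
Proof.
rewrite /inner; under [RHS]eq_bigr do rewrite mulr_sumr.
rewrite exchange_big; apply: eq_bigr => K _.
by rewrite sum_ffunE mulr_suml; apply: eq_bigr => i _; rewrite ffunE mulrA.
Qed.

Lemma inner_addr f delta1 delta2 :
  inner f (delta1 + delta2) = inner f delta1 + inner f delta2.
Proof.
by rewrite -big_split; apply: eq_bigr => K _; rewrite ffunE mulrDr.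
Qed.

Lemma inner_scaler f (a : R) delta : inner f (a *: delta) = a * inner f delta.
Proof. by rewrite mulr_sumr; apply: eq_bigr => K _; rewrite ffunE mulrCA. Qed.

(** A design pairs to [lambda] with every generator, so the sum of the coefficients of [f] serves as
    [c]. *)
Lemma inclusion_span_constant f :
  f \in inclusion_span R V k t -> exists c, real_design_constant t f c.
Proof.
rewrite /inclusion_span; set X := [seq _ | _ : _].
move=> /(coord_span (X := in_tuple X)) ->.
exists (\sum_i (coord (in_tuple X) i f : R)) => lambda delta delta_design.
rewrite inner_sumZl mulr_sumr; apply: eq_bigr => i _; rewrite mulrC.
have /imageP[T _ ->] : X`_i \in X by apply: mem_nth.
by rewrite delta_design.
Qed.

(** Integral kernel vectors of the inclusion matrix [A] are signed null designs, so
    [rational_row_space] applies to the value vector of [f]. *)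
Lemma integral_null_designs_span f :
  (forall delta : gfun R V k, signed_design t 0 delta -> inner f delta = 0) ->
  f \in inclusion_span R V k t.
Proof.
move=> f_orth.
pose A : 'M[rat]_(#|grass V t|, #|grass V k|) :=
  \matrix_(i, j) (incl (val (enum_val i)) (val (enum_val j)))%:R.
pose v : 'rV[R]_#|grass V k| := \row_j (f (enum_val j) : R).
have sum_grass (F : grass V k -> R) :
  \sum_K F K = \sum_(j < #|grass V k|) F (enum_val j).
  by rewrite -big_enum_val.
have /submxP[a va] : (v <= map_mx ratr A)%MS.
  apply: rational_row_space => y Ay0.
  pose delta : gfun R V k := [ffun K => (y (enum_rank K) ord0)%:~R].
  have := f_orth delta; rewrite /inner sum_grass => f_delta.
  apply/matrixP => i j; rewrite !mxE -[RHS]f_delta.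
    by apply: eq_bigr => l _; rewrite !mxE ffunE enum_valK (ord1 j).
  split=> [T|K]; last by rewrite ffunE intr_int.
  rewrite /inner sum_grass.
  have /matrixP/(_ (enum_rank T) ord0) := Ay0; rewrite !mxE.
  move=> /(congr1 (@ratr R)); rewrite rmorph0 rmorph_sum => sum0.
  rewrite -[RHS]sum0.
  apply: eq_bigr => l _; rewrite !mxE !ffunE enum_rankK enum_valK rmorphM /=.
  by rewrite ratr_nat ratr_int.
have -> : f =
    \sum_(i < #|grass V t|) (a ord0 i : R) *: charfun R k (val (enum_val i)).
  apply/ffunP => K; rewrite sum_ffunE.
  have /rowP/(_ (enum_rank K)) := va; rewrite !mxE enum_rankK => ->.
  by apply: eq_bigr => i _; rewrite !mxE !ffunE enum_rankK ratr_nat.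
rewrite memv_suml // => i _; rewrite memvZ ?memv_span //.
exact: image_f.
Qed.

Definition complete_design : gfun R V k := [ffun=> 1].

Lemma inner_complete_design f : inner f complete_design = weight f.
Proof. by apply: eq_bigr => K _; rewrite ffunE mulr1. Qed.

(** Pairing [charfun] of [T] with the constant [1] counts the rank-[k] subspaces above [T]. *)
Lemma complete_design_real : (t <= k)%N ->
  real_design t (gauss_binom R (ambient_q V) (ambient_rk V - t) (k - t))
    complete_design.
Proof.
move=> htk T; rewrite inner_complete_design /weight.
have rkT : rk (val T) = t by apply/eqP/(valP T).
have := card_grass_over R V k (val T); rewrite rkT => /(_ htk) <-.
rewrite -sum1_card natr_sum [RHS]big_mkcond /=; apply: eq_bigr => K _.
by rewrite ffunE inE; case: incl.
Qed.

End Designs.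

Theorem theorem3p5 (R : realType) (V : ambient) (k t : nat)
    (hk : (k <= ambient_rk V)%N)
    (ht : (t <= minn k (ambient_rk V - k))%N)
    (f : gfun R V k) :
  let lambda_max : R :=
    gauss_binom R (ambient_q V) (ambient_rk V - t) (k - t) in
  [<-> f \in inclusion_span R V k t;
       exists c : R, real_design_constant t f c;
       forall delta : gfun R V k,
         signed_design t 0 delta -> inner f delta = 0;
       exists c : R, nat_design_constant t f c]
  /\ (forall c : R, real_design_constant t f c ->
        c = lambda_max^-1 * weight f)
  /\ (forall c : R, nat_design_constant t f c ->
        c = lambda_max^-1 * weight f).
Proof.
move=> lambda_max; have htk : (t <= k)%N by lia.
have q_gt0 : (0 < ambient_q V)%N.
  by case: (V) => [T|F W] //=; apply: ltnW (finNzRing_gt1 F).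
have lambda_neq0 : lambda_max != 0 by rewrite gauss_binom_neq0 // leq_sub2r.
have complete_real : real_design t lambda_max complete_design :=
  complete_design_real htk.
(* [gauss_binom] is defined as a real quotient; it is a natural number here because it counts the
   subspaces above some [T] of rank [t]. *)
have [m lambdaE] : exists m : nat, lambda_max = m%:R.
  have [T /eqP rkT] := exists_grass _ _ (leq_trans htk hk).
  by have := card_grass_over R V k T; rewrite rkT -/lambda_max => /(_ htk) <-;
    eexists.
have complete_nat : nat_design t m%:R (complete_design : gfun R V k).
  by split=> [|K]; [rewrite -lambdaE | rewrite ffunE].
split; last split.
- tfae.
  + exact: inclusion_span_constant.
  + by move=> [c f_c] delta [] /f_c ->; rewrite mul0r.
  + move=> f_orth; exists (lambda_max^-1 * weight f) => lambda delta.
    move=> [delta_real delta_nat].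
    (* Scaling [delta] by [lambda_max], instead of dividing the constant function by it, keeps this
       null design integral. *)
    have := f_orth (lambda_max *: delta + (- lambda%:R) *: complete_design).
    rewrite inner_addr !inner_scaler inner_complete_design => null.
    apply: (mulfI lambda_neq0); rewrite mulrCA mulVKf //.
    apply/eqP; rewrite -subr_eq0 -mulNr null //; split=> [T|K].
      rewrite inner_addr !inner_scaler delta_real complete_real.
      by rewrite mulNr mulrC subrr.
    by rewrite !ffunE lambdaE rpredD ?rpredM ?rpredN ?rpred1 ?intr_nat
      ?natr_nat.
  + move=> [c f_c]; apply: integral_null_designs_span => delta [null delta_int].
    (* Condition (iii) is recovered first. The sum [b] of all absolute values bounds every
       [- delta K], so adding [b] times the constant [1] makes [delta] a design with natural values.
       Its pairing with [f] is [b] times that of the complete design, which leaves [0] for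
       [delta]. *)
    have /natrP[b bE] : \sum_K `|delta K : R| \is a Num.nat.
      by apply: rpred_sum => K _; apply: natr_norm_int.
    have shift_nat : nat_design t (b * m)%:R (delta + b%:R *: complete_design).
      split=> [T|K].
        by rewrite inner_addr inner_scaler null complete_real add0r natrM
          lambdaE.
      have -> : (delta + b%:R *: complete_design) K = delta K + b%:R :> R.
        by rewrite !ffunE; congr (_ + _); apply: mulr1.
      rewrite natrEint rpredD ?rpred_nat //= -bE.
      rewrite (bigD1 K) //= addrA addr_ge0 ?sumr_ge0 // -lerBlDl sub0r.
      by rewrite -normrN ler_norm.
    have := f_c _ _ shift_nat.
    rewrite inner_addr inner_scaler (f_c _ _ complete_nat).
    by rewrite natrM -mulrA -[RHS]add0r => /addIr.
(* Testing on the complete design gives [weight f = lambda_max * c], which determines [c]. *)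
- move=> c /(_ _ _ complete_real); rewrite inner_complete_design => ->.
  by rewrite mulKf.
- move=> c /(_ _ _ complete_nat); rewrite inner_complete_design -lambdaE => ->.
  by rewrite mulKf.
Qed.
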